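(* Let $S$ be a closed topological surface with a cellular decomposition $\Sigma=(V,E,F)$ and let $\Phi\in(0,\frac{\pi}{2})^{|E|}$ be a weight. Let $\hat L=(\hat L_1,\dots,\hat L_{|F|})^T\in\mathbb{R}^{|F|}$ be a prescribed total geodesic curvature on the face set $F$. Then there exists a degenerated circle pattern metric on $S$ with total geodesic curvature $\hat L$ if and only if $\hat L\in\bar\partial\mathcal{L}$, where $$\bar\partial\mathcal{L}=\Big(\bigcup_{1\le m\le |F|-1,\ 1\le i_1<\cdots<i_m\le |F|}\mathcal{L}_{i_1\cdots i_m}\Big)\cup\{0\}$$ and $\mathcal{L}_{i_1\cdots i_m}$ is the set of all $(L_1,\dots,L_{|F|})^T\in\mathbb{R}^{|F|}$ such that $L_{i_j}>0$ for $1\le j\le m$, $L_i=0$ for $i\notin F_{i_1\cdots i_m}:=\{i_1,\dots,i_m\}$, and $\sum_{f\in F'}L_f<2\sum_{e\in E_{F'}}\Phi(e)$ for every nonempty $F'\subset F_{i_1\cdots i_m}$. Moreover, the degenerated circle pattern metric is unique up to isometry if it exists.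
   Context: Cellular decomposition: $V,E,F$ are the finite sets of 0-, 1- and 2-cells of $\Sigma$, and $F=\{1,\dots,|F|\}$. For $f\in F$, $E_f$ is the set of 1-cells contained in $\partial f$ (every face has at least one such 1-cell). For $F'\subset F$, $E_{F'}=\{e\in E : \exists f\in F',\ e\in E_f\}$. The 2-cells on the two sides of $e\in E$ are denoted $f_1(e),f_2(e)$ (possibly equal). Bigons: for $r_1,r_2\in(0,\frac{\pi}{2}]$ and $\phi\in(0,\frac{\pi}{2})$, there are round disks $D_1,D_2\subset\mathbb{S}^2$ (unit sphere) of radii $r_1,r_2$, unique up to isometry, such that $D_1\cap D_2$ is a bigon with interior angle $\phi$; the distance $r_3$ between the centers satisfies $\cos r_3=\cos r_1\cos r_2-\sin r_1\sin r_2\cos\phi$. The two sides of the bigon are arcs of $\partial D_1$ and $\partial D_2$, of lengths $\ell_1,\ell_2$. The geodesic curvature of $\partial D_i$ is $k_i=\cot r_i\ge 0$, and the total geodesic curvature of the side on $\partial D_i$ is $\ell_ik_i$. Metrics: given radii $\mathbf r=(r_1,\dots,r_{|F|})\in(0,\frac{\pi}{2}]^{|F|}$, choose an auxiliary point in each 2-cell and join it to the vertices on the boundary of that 2-cell; for $e\in E$ let $Q(e)$ be the quadrilateral whose vertices are the end points of $e$ and the auxiliary points of the two 2-cells adjacent to $e$. Give $Q(e)$ the spherical metric of the quadrilateral whose vertices are the centers of two disks in $\mathbb{S}^2$ of radii $r_{f_1(e)},r_{f_2(e)}$ with intersection angle $\Phi(e)$ (interior angle of the bigon $B_e$ formed by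 their intersection) and the two intersection points of their boundary circles. Gluing the $Q(e)$ along their sides gives a spherical conical metric on $S$ together with a circle pattern (one disk of radius $r_f$ for each $f\in F$) realizing $\Phi$. Put $k_f=\cot r_f$; the metric with its circle pattern is identified with the vector $k=(k_1,\dots,k_{|F|})^T\in\mathbb{R}_{\ge0}^{|F|}$, which determines it up to isometry, so that ''unique up to isometry'' means that $k$ is unique. It is called a spherical conical metric for any $k\in\mathbb{R}^{|F|}_{\ge0}$, a circle pattern metric if all $k_f>0$ (all $r_f<\frac{\pi}{2}$), and a degenerated circle pattern metric if some $k_f=0$ (some $r_f=\frac{\pi}{2}$). Total geodesic curvature: for $e\in E_f$, $L_{f,e}=\ell_{f,e}k_f$, where $\ell_{f,e}$ is the length of the side of $B_e$ lying on the boundary of the disk of $f$. The total geodesic curvature of $f$ is $L_f=\sum_{e\in E_f}L_{f,e}$ (if $f$ lies on both sides of $e$, both sides of $B_e$ are counted). The metric has total geodesic curvature $\hat L$ if $L_f=\hat L_f$ for all $f\in F$. *)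

(* Defs.v *)
From mathcomp Require Import all_boot all_order all_algebra.
From mathcomp Require Import all_classical all_reals all_analysis.

Set Implicit Arguments.
Unset Strict Implicit.
Unset Printing Implicit Defensive.

Import Order.TTheory GRing.Theory Num.Theory.
Import numFieldNormedType.Exports.

Local Open Scope classical_set_scope.
Local Open Scope ring_scope.

(** * Closed surfaces and cellular decompositions *)

Definition open_embedding (X Y : topologicalType) (h : X -> Y) : Prop :=
  [/\ continuous h, injective h & forall A : set X, open A -> open (h @` A)].

(* Second countability follows from compactness and the charts.
   Connectedness is not required. *)
Record closed_surface (R : realType) (S : topologicalType) : Prop := {
  surface_nonempty : [set: S] !=set0;
  surface_hausdorff : hausdorff_space S;
  surface_compact : compact [set: S];
  surface_chart : forall x : S,
    exists2 h : R * R -> S, open_embedding h & h (0, 0) = x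
}.

Definition open_disk {R : realType} : set (R * R) :=
  [set p | p.1 ^+ 2 + p.2 ^+ 2 < 1].
Definition closed_disk {R : realType} : set (R * R) :=
  [set p | p.1 ^+ 2 + p.2 ^+ 2 <= 1].
Definition unit_circle {R : realType} : set (R * R) :=
  [set p | p.1 ^+ 2 + p.2 ^+ 2 = 1].

Definition frontier (S : topologicalType) (A : set S) : set S :=
  closure A `\` A.

(* A finite CW structure, given by characteristic maps; only the values of
   [arc e] on [-1, 1] and of [disc f] on the closed unit disk matter.  When S is
   compact Hausdorff, such a map is automatically a homeomorphism from the
   open interval or open disk onto the open cell. *)
Record cellular_decomposition (R : realType) (S : topologicalType) := {
  V : finType;
  E : finType;
  nF : nat;
  vtx : V -> S;
  arc : E -> R -> S;
  disc : 'I_nF -> R * R -> S;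
  cell0 := fun v : V => [set vtx v];
  cell1 := fun e : E => arc e @` `]-1, 1[;
  cell2 := fun f : 'I_nF => disc f @` open_disk;
  arc_continuous : forall e, {within `[-1, 1], continuous (arc e)};
  arc_inj : forall e, set_inj `]-1, 1[ (arc e);
  arc_ends : forall e, range vtx (arc e (-1)) /\ range vtx (arc e 1);
  disc_continuous : forall f, {within closed_disk, continuous (disc f)};
  disc_inj : forall f, set_inj open_disk (disc f);
  disc_boundary : forall f,
    disc f @` unit_circle `<=` range vtx `|` \bigcup_e cell1 e;
  cells_disjoint : trivIset [set: V + E + 'I_nF] (fun c =>
    match c with
    | inl (inl v) => cell0 v
    | inl (inr e) => cell1 e
    | inr f => cell2 f
    end);
  cells_cover :
    range vtx `|` \bigcup_e cell1 e `|` \bigcup_f cell2 f = [set: S];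
  (* The 2-cells f_1(e), f_2(e) on the two sides of e: near each point of e
     there is a chart taking the horizontal axis into e and the upper
     (resp. lower) half-plane into f_1(e) (resp. f_2(e)). *)
  side1 : E -> 'I_nF;
  side2 : E -> 'I_nF;
  sides : forall e x, cell1 e x -> exists h : R * R -> S,
    [/\ open_embedding h, h (0, 0) = x &
      forall s t, [/\ t = 0 -> cell1 e (h (s, t)),
                      0 < t -> cell2 (side1 e) (h (s, t)) &
                      t < 0 -> cell2 (side2 e) (h (s, t))]];
  face_has_edge : forall f, exists e, cell1 e `<=` frontier (cell2 f)
}.

Section Edges.
Context {R : realType} {S : topologicalType}.
Variable D : cellular_decomposition R S.

(* E_f *)
Definition edges_of_face (f : 'I_(nF D)) : {set E D} :=
  finset (fun e => `[< cell1 e `<=` frontier (cell2 f) >]).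

(* E_{F'} *)
Definition edges_of_faces (F' : {set 'I_(nF D)}) : {set E D} :=
  finset (fun e => [exists f in F', e \in edges_of_face f]).

End Edges.

(** * Spherical bigons *)

Section Bigon.
Context {R : realType}.
Implicit Types (r phi t : R) (x y c : 'rV[R]_3).

Definition vec3 (a b c : R) : 'rV[R]_3 := \row_j [:: a; b; c]`_j.

Definition dot x y : R := \sum_j x 0 j * y 0 j.

Definition sphere : set 'rV[R]_3 := [set x | dot x x = 1].

Definition sphere_dist x y : R := acos (dot x y).

Definition round_disk c r : set 'rV[R]_3 :=
  [set x | sphere x /\ sphere_dist c x <= r].

(* Distance between the centers of two disks of radii r1, r2 whose
   intersection is a bigon with interior angle phi: the radii to a vertex of
   the bigon meet there at the angle pi - phi. *)
Definition center_dist r1 r2 phi : R :=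
  acos (cos r1 * cos r2 - sin r1 * sin r2 * cos phi).

(* The point at distance r from the north pole (0, 0, 1), longitude t. *)
Definition sphere_point r t : 'rV[R]_3 :=
  vec3 (sin r * cos t) (sin r * sin t) (cos r).

(* Normalize the bigon so that D1 is centered at the north pole and D2 at
   longitude 0.  The side of D1 /\ D2 on the circle bounding D1, which is
   parametrized by longitude with constant speed sin r1, is the set of its
   points in D2. *)
Definition bigon_side_length r1 r2 phi : R :=
  sin r1 * fine (lebesgue_measure
    [set t | - pi < t <= pi /\
       round_disk (sphere_point (center_dist r1 r2 phi) 0) r2
         (sphere_point r1 t)]).

(* The inverse of cot : ]0, pi/2] -> [0, +oo[. *)
Definition radius (k : R) : R := pi / 2 - atan k.

Lemma radius_bounds (k : R) : 0 <= k -> 0 < radius k <= pi / 2.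
Proof.
move=> k0; rewrite /radius subr_gt0 atan_ltpi2 /= gerBl.
by rewrite -(@atan0 R) le_atan.
Qed.

Lemma cot_radius (k : R) : cos (radius k) / sin (radius k) = k.
Proof.
rewrite /radius cosB sinB cos_pihalf sin_pihalf !mul0r !mul1r add0r subr0.
exact: atanK.
Qed.

End Bigon.

(** * Circle pattern metrics *)

Section CirclePatterns.
Context {R : realType} {S : topologicalType}.
Variable D : cellular_decomposition R S.
Variable Phi : E D -> R.
Implicit Types (k L : 'cV[R]_(nF D)) (f : 'I_(nF D)) (A : {set 'I_(nF D)}).

(* A spherical conical metric with its circle pattern is represented by the
   geodesic curvatures k_f = cot r_f of the circles. *)
Definition spherical_conical_metric k : Prop := forall f, 0 <= k f 0.

Definition degenerated_metric k : Prop :=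
  spherical_conical_metric k /\ exists f, k f 0 = 0.

(* Total geodesic curvature of the side, on the circle of f, of a bigon of
   angle phi between the disks of f and g. *)
Definition side_curvature k f g (phi : R) : R :=
  bigon_side_length (radius (k f 0)) (radius (k g 0)) phi * k f 0.

(* L_{f,e}, counting both sides of the bigon when f is on both sides of e. *)
Definition edge_curvature k f (e : E D) : R :=
  (if side1 e == f then side_curvature k f (side2 e) (Phi e) else 0) +
  (if side2 e == f then side_curvature k f (side1 e) (Phi e) else 0).

Definition total_curvature k f : R :=
  \sum_(e in edges_of_face f) edge_curvature k f e.

Definition has_total_curvature k L : Prop :=
  forall f, total_curvature k f = L f 0.

(* L_{i_1 ... i_m} for A = {i_1, ..., i_m}. *)
Definition curvature_stratum A : set 'cV[R]_(nF D) :=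
  [set L | [/\ forall i, i \in A -> 0 < L i 0,
               forall i, i \notin A -> L i 0 = 0 &
               forall F' : {set 'I_(nF D)}, F' != finset.set0 -> F' \subset A ->
                 \sum_(f in F') L f 0 <
                   2 * \sum_(e in edges_of_faces F') Phi e]].

Definition degenerated_curvatures : set 'cV[R]_(nF D) :=
  (\bigcup_(A in [set A : {set 'I_(nF D)} | (1 <= #|A| <= nF D - 1)%N])
     curvature_stratum A) `|` [set 0].

End CirclePatterns.

(* Main.v *)
Require Import Defs.
From mathcomp Require Import all_boot all_order all_algebra.
From mathcomp Require Import all_classical all_reals all_analysis.
From mathcomp Require Import ring lra.

Import Order.TTheory GRing.Theory Num.Theory.
Import numFieldNormedType.Exports.
Local Open Scope classical_set_scope.
Local Open Scope ring_scope.

(** The side of a bigon of angle [phi] that lies on the circle of curvature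
    [x], the other circle having curvature [y], has total geodesic curvature
      [2 u acot (u Y)],  [u = sin (atan x)],  [Y = (y / x + cos phi) / sin phi]
    (with value 0 at [x = 0]).  Two facts about this formula drive the proof.
    First, it decreases with [y], and it increases strictly when [x] and [y]
    are multiplied by a common factor [c > 1]: scaling leaves [Y] unchanged,
    increases [u], and [z acot z] is increasing because [sin t < t]
    ([bigon_curvature_antitone], [bigon_curvature_scale_lt]).  Second, as the
    scale tends to infinity the picture becomes Euclidean: [u] tends to 1 and
    the curvature to [2 acot Y], where [acot Y] is an angle of a Euclidean
    triangle whose two angles at the circle centers add up to [phi]
    ([flat_angle_sum]).

    Everything then happens on the dual graph, whose vertices are the 2-cells
    and whose edges are the 1-cells ([edges_of_faceE]).  Let [T k] be the vector
    of total curvatures, and let [A] be the set of faces with positive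
    curvature; it is also the set of faces with positive total curvature.

    Necessity of the inequalities: grouping the terms of the sum over [F'] by
    edges, an edge with one side in [F'] contributes less than [2 phi], and so
    does an edge with both sides in [F'], by comparison with the Euclidean
    angles ([edge_curvature_lt]).

    Uniqueness is a maximum principle: if [T k = T k'] and the largest ratio
    [c = k f / k' f] exceeds 1, then [k <= c k'] with equality at [f], whence
    [T k f >= T (c k') f > T k' f] ([comparison_principle]).

    Existence is Perron's method.  Subsolutions, the [k] supported in [A] with
    [T k <= L] on [A], are stable under maxima.  If they are bounded, their
    supremum is a solution ([perron_solution]).  If not, let [F'] be the set of
    faces on which they are unbounded; some subsolutions are large on all of
    [F'] at once and bounded elsewhere ([subsolution_blowup]), and then every
    edge that meets [F'] contributes almost [2 phi] to the sum of [T k] over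
    [F'], so that the sum of [L] over [F'] is at least
    [2 \sum_(e in E_F') Phi e], against the hypothesis on [L]. *)

(* The map from curvatures to radii is the inverse cotangent with values in
   ]0, pi[; it also computes the angles below. *)
Local Notation acot := Defs.radius.

(** * The inverse cotangent *)

Section Acot.
Context {R : realType}.
Implicit Types (x y z t u phi : R).

Lemma sin_lt_id t : 0 < t -> sin t < t.
Proof.
move=> t0; have [tpi|pit] := leP t pi; last first.
  apply: le_lt_trans pit; apply: le_trans (sin_le1 _) _.
  by have := pi_ge2 R; lra.
have [c /[!in_itv]/= /andP[c0 ct]] :
    exists2 c, c \in `]0, t[%R & sin t - sin 0 = cos c * (t - 0).
  apply: MVT => // x.
  exact/continuous_subspaceT/continuous_sin.
rewrite sin0 !subr0 => ->; rewrite gtr_pMl// -(cos0 R) ltr_cos// in_itv/=.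
- by rewrite lexx pi_ge0.
- by rewrite ltW//= ltW// (lt_le_trans ct).
Qed.

Lemma acot_lt x y : x < y -> acot y < acot x.
Proof. by move=> xy; rewrite /Defs.radius ltrD2l ltrN2 lt_atan. Qed.

Lemma acot_le x y : x <= y -> acot y <= acot x.
Proof. by move=> xy; rewrite /Defs.radius lerD2l lerN2 le_atan. Qed.

Lemma acot_gt0 x : 0 < acot x.
Proof. by rewrite subr_gt0 atan_ltpi2. Qed.

Lemma cos_atan_gt0 x : 0 < cos (atan x).
Proof. by rewrite cos_gt0_pihalf// atan_gtNpi2 atan_ltpi2. Qed.

Lemma sin_atan x : sin (atan x) = x * cos (atan x).
Proof. by rewrite -[X in _ = X * _](atanK x) /tan divfK// gt_eqF ?cos_atan_gt0. Qed.

Lemma cos_acot x : cos (acot x) = sin (atan x).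
Proof. by rewrite /Defs.radius cosB cos_pihalf sin_pihalf mul0r mul1r add0r. Qed.

Lemma sin_acot x : sin (acot x) = cos (atan x).
Proof. by rewrite /Defs.radius sinB cos_pihalf sin_pihalf mul0r mul1r subr0. Qed.

Lemma cos_atan2 x : cos (atan x) ^+ 2 * (1 + x ^+ 2) = 1.
Proof.
by rewrite -[RHS](cos2Dsin2 (atan x)) sin_atan; ring.
Qed.

Lemma acot_cot phi : 0 < phi < pi -> acot (cos phi / sin phi) = phi.
Proof.
move=> /andP[p0 p1].
have -> : cos phi / sin phi = tan (pi / 2 - phi).
  by rewrite /tan sinB cosB sin_pihalf cos_pihalf; congr (_ / _); ring.
by rewrite /Defs.radius tanK ?in_itv /=; [ring|apply/andP; split; lra].
Qed.

(** In terms of [t = acot z] the product [z * acot z] is [t * cot t], and its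
    derivative with respect to [z] is [t - sin t * cos t]. *)
Lemma mul_acot_lt x y : 0 <= x -> x < y -> x * acot x < y * acot y.
Proof.
move=> x0 xy; rewrite -subr_gt0.
pose f z := z * acot z; pose df z := acot z - z / (1 + z ^+ 2).
have fd z : is_derive z 1 f (df z).
  rewrite /f /df /Defs.radius; apply: is_derive_eq.
  by rewrite /GRing.scale/=; field; have := sqr_ge0 z; lra.
have [c /[!in_itv]/= /andP[c0 cy]] :
    exists2 c, c \in `]x, y[%R & f y - f x = df c * (y - x).
  apply: MVT => //; apply: derivable_within_continuous => z _.
  exact: ex_derive.
rewrite /f => ->; rewrite mulr_gt0 ?subr_gt0// /df.
have c21 : 0 < 1 + c ^+ 2 by have := sqr_ge0 c; lra.
have -> : c / (1 + c ^+ 2) = sin (acot c *+ 2) / 2.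
  transitivity (c * (cos (atan c) ^+ 2 * (1 + c ^+ 2)) / (1 + c ^+ 2)).
    by rewrite cos_atan2 mulr1.
  by rewrite sin_mulr2n cos_acot sin_acot sin_atan; field; rewrite gt_eqF.
have : sin (acot c *+ 2) < acot c *+ 2.
  by rewrite sin_lt_id// pmulrn_lgt0// acot_gt0.
by lra.
Qed.

Lemma mul_acot_scale_lt u v Y : 0 <= u -> u < v -> 0 <= Y ->
  u * acot (u * Y) < v * acot (v * Y).
Proof.
move=> u0 uv; rewrite le_eqVlt => /predU1P[<-|Y0].
  by rewrite !mulr0 ltr_pM2r// acot_gt0.
rewrite -(ltr_pM2r Y0) ![_ * _ * Y]mulrAC mul_acot_lt ?ltr_pM2r//.
by rewrite mulr_ge0// ltW.
Qed.

End Acot.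

(** * Curvature of the side of a bigon *)

Section Bigon.
Context {R : realType}.
Variable phi : R.
Hypothesis hphi : 0 < phi < pi / 2.
Implicit Types (x y t c : R).

(** Total geodesic curvature of a side of a bigon of angle [phi].  The circle
    of curvature [x] has radius [r = acot x], and the [acot] factor is half the
    angle that the side subtends at its center (see [bigon_side_lengthE]); the
    curvature [2 * acot _ * sin r * x] involves [sin r * x = cos r], which is
    [sin (atan x)].  Written in this way the formula is continuous in [x] up to
    and beyond [x = 0]. *)
Definition bigon_curvature x y : R :=
  2 * (sin (atan x) * acot (cos (atan x) * ((y + x * cos phi) / sin phi))).

(** The Euclidean counterpart of that half angle: the angle at the first center
    in the triangle formed by a common point and the centers of two circles of
    radii [1 / x] and [1 / y] in the plane. *)
Definition flat_angle x y : R := acot ((y / x + cos phi) / sin phi).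

Lemma sin_phi_gt0 : 0 < sin phi.
Proof. by rewrite sin_gt0_pihalf. Qed.

Lemma cos_phi_gt0 : 0 < cos phi.
Proof.
by rewrite cos_gt0_pihalf//; case/andP: hphi => p0 ->; rewrite andbT; have := pi_gt0 R; lra.
Qed.

Lemma phi_bounds : 0 < phi < pi.
Proof. by case/andP: hphi => p0 p1; rewrite p0/=; have := pi_gt0 R; lra. Qed.

Lemma acot_cot_phi : acot (cos phi / sin phi) = phi.
Proof. by rewrite acot_cot// phi_bounds. Qed.

Lemma sin_atan_gt0 x : 0 < x -> 0 < sin (atan x).
Proof. by move=> x0; rewrite sin_atan mulr_gt0// cos_atan_gt0. Qed.

Lemma sin_atan_ge0 x : 0 <= x -> 0 <= sin (atan x).
Proof. by move=> x0; rewrite sin_atan mulr_ge0// ltW// cos_atan_gt0. Qed.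

Lemma sin_atan_lt x y : x < y -> sin (atan x) < sin (atan y).
Proof.
move=> xy; rewrite ltr_sin ?lt_atan// in_itv/= !ltW//.
all: by rewrite ?atan_gtNpi2 ?atan_ltpi2.
Qed.

Lemma sin_atan_lt1 x : sin (atan x) < 1.
Proof.
rewrite -(sin_pihalf R) ltr_sin ?atan_ltpi2// in_itv/= ?lexx ?andbT.
  by rewrite !ltW// ?atan_gtNpi2 ?atan_ltpi2.
by rewrite lerNl; have := pihalf_ge1 R; lra.
Qed.

Lemma bigon_curvature0 y : bigon_curvature 0 y = 0.
Proof. by rewrite /bigon_curvature sin_atan !mul0r mulr0. Qed.

(** Only [sin (atan x)] depends on the scale: the ratio [y / x] does not. *)
Lemma bigon_curvatureE x y : 0 < x ->
  bigon_curvature x y =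
  2 * (sin (atan x) * acot (sin (atan x) * ((y / x + cos phi) / sin phi))).
Proof.
move=> x0; rewrite /bigon_curvature; congr (2 * (_ * acot _)).
rewrite sin_atan; field.
by rewrite !gt_eqF ?sin_phi_gt0.
Qed.

Lemma bigon_curvature_gt0 x y : 0 < x -> 0 < bigon_curvature x y.
Proof. by move=> x0; rewrite !mulr_gt0 ?sin_atan_gt0 ?acot_gt0. Qed.

Lemma bigon_curvature_antitone x y y' : 0 <= x -> y <= y' ->
  bigon_curvature x y' <= bigon_curvature x y.
Proof.
move=> x0 yy'; rewrite ler_pM2l// ler_wpM2l ?sin_atan_ge0// acot_le//.
by rewrite ler_pM2l ?cos_atan_gt0// ler_pM2r ?invr_gt0 ?sin_phi_gt0// lerD2r.
Qed.

Lemma flat_cot_gt0 x y : 0 < x -> 0 <= y -> 0 < (y / x + cos phi) / sin phi.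
Proof.
move=> x0 y0; rewrite divr_gt0 ?sin_phi_gt0// ltr_wpDl ?cos_phi_gt0//.
by rewrite divr_ge0// ltW.
Qed.

Lemma bigon_curvature_scale_lt c x y : 1 < c -> 0 < x -> 0 <= y ->
  bigon_curvature x y < bigon_curvature (c * x) (c * y).
Proof.
move=> c1 x0 y0; have c0 : 0 < c by apply: lt_trans c1.
have cx0 : 0 < c * x by rewrite mulr_gt0.
rewrite !bigon_curvatureE//.
have -> : c * y / (c * x) = y / x by field; rewrite !gt_eqF.
rewrite ltr_pM2l// mul_acot_scale_lt ?sin_atan_ge0 ?(ltW x0)//.
  by rewrite sin_atan_lt// ltr_pMl.
exact/ltW/flat_cot_gt0.
Qed.

(** The curvature increases with the scale and twice the flat angle, obtained
    for [sin (atan x) = 1], is its limit. *)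
Lemma bigon_curvature_lt_flat x y : 0 < x -> 0 <= y ->
  bigon_curvature x y < 2 * flat_angle x y.
Proof.
move=> x0 y0; rewrite bigon_curvatureE// ltr_pM2l//.
rewrite /flat_angle -[X in _ < acot X]mul1r -[ltRHS]mul1r.
rewrite mul_acot_scale_lt ?sin_atan_ge0 ?(ltW x0) ?sin_atan_lt1//.
exact/ltW/flat_cot_gt0.
Qed.

Lemma bigon_curvature_ge_flat x y : 0 < x -> 0 <= y ->
  2 * (sin (atan x) * flat_angle x y) <= bigon_curvature x y.
Proof.
move=> x0 y0; rewrite bigon_curvatureE// ler_pM2l// ler_pM2l ?sin_atan_gt0//.
by rewrite acot_le// ler_piMl ?sin_le1// ltW ?flat_cot_gt0.
Qed.

Lemma flat_angle_le x y : 0 < x -> 0 <= y -> flat_angle x y <= phi.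
Proof.
move=> x0 y0; rewrite -[leRHS]acot_cot_phi acot_le// ler_pM2r ?invr_gt0 ?sin_phi_gt0//.
by rewrite lerDr divr_ge0// ltW.
Qed.

(** The Euclidean triangle of the two centers and a common point has angle
    [pi - phi] at that point, and its angles add up to [pi]. *)
Lemma flat_angle_sum x y : 0 < x -> 0 < y ->
  flat_angle x y + flat_angle y x = phi.
Proof.
move=> x0 y0; have s0 := sin_phi_gt0.
pose X := (y / x + cos phi) / sin phi.
have XE : sin phi * X - cos phi = y / x by rewrite /X; field; rewrite !gt_eqF.
have a_gt0 : 0 < acot X by exact: acot_gt0.
have a_lt : acot X < phi.
  rewrite -[ltRHS]acot_cot_phi acot_lt// ltr_pM2r ?invr_gt0//.
  by rewrite ltrDr divr_gt0.
suff -> : flat_angle y x = phi - acot X by rewrite /flat_angle -/X; ring.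
have C0 := cos_atan_gt0 X.
rewrite -[RHS]acot_cot; last first.
  by have/andP[p0 p1] := phi_bounds; apply/andP; split; lra.
congr acot; rewrite cosB sinB cos_acot sin_acot sin_atan.
have -> : sin phi * (X * cos (atan X)) - cos phi * cos (atan X) =
          y / x * cos (atan X) by rewrite -XE; ring.
have -> : cos phi * (X * cos (atan X)) + sin phi * cos (atan X) =
   (y / x * cos phi + (cos phi ^+ 2 + sin phi ^+ 2)) / sin phi * cos (atan X).
  by rewrite /X; field; rewrite !gt_eqF.
by rewrite cos2Dsin2; field; rewrite !gt_eqF.
Qed.

Lemma continuous_acot : continuous (acot : R -> R).
Proof.
move=> x; rewrite /Defs.radius; apply: cvgB; first exact: cvg_cst.
exact: continuous_atan.
Qed.

(** The second curvature is a function of the first one because, for a circle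
    that meets itself, the two vary together. *)
Lemma continuous_bigon_curvature (y : R -> R) : continuous y ->
  continuous (fun t => bigon_curvature t (y t)).
Proof.
move=> cy t; rewrite /bigon_curvature; apply: cvgM; first exact: cvg_cst.
apply: cvgM.
  by apply: continuous_comp; [exact: continuous_atan|exact: continuous_sin].
apply: (@continuous_comp _ _ _
  (fun t => cos (atan t) * ((y t + t * cos phi) / sin phi)) acot);
  last exact: continuous_acot.
apply: cvgM.
  by apply: continuous_comp; [exact: continuous_atan|exact: continuous_cos].
apply: cvgMr_tmp; apply: cvgD; first exact: cy.
by apply: cvgMr_tmp; exact: cvg_id.
Qed.

End Bigon.

(** * The length of the side of a bigon *)

Section Length.
Context {R : realType}.
Variable phi : R.
Hypothesis hphi : 0 < phi < pi / 2.
Implicit Types (x y t c : R).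

Lemma dot_sphere_point d r t :
  dot (sphere_point d 0) (sphere_point r t) =
  sin d * sin r * cos t + cos d * cos r :> R.
Proof.
rewrite /dot !big_ord_recl big_ord0 /sphere_point /vec3 !mxE /= cos0 sin0; ring.
Qed.

(** The squared norms of [u - v] and [u + v] are nonnegative. *)
Lemma dot_le1 (u v : 'rV[R]_3) : sphere u -> sphere v -> -1 <= dot u v <= 1.
Proof.
rewrite /sphere/= /dot !big_ord_recl !big_ord0.
set u1 := u _ _; set u2 := u _ _; set u3 := u _ _.
set v1 := v _ _; set v2 := v _ _; set v3 := v _ _ => hu hv.
have := sqr_ge0 (u1 - v1); have := sqr_ge0 (u2 - v2); have := sqr_ge0 (u3 - v3).
have := sqr_ge0 (u1 + v1); have := sqr_ge0 (u2 + v2); have := sqr_ge0 (u3 + v3).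
by move=> *; apply/andP; split; lra.
Qed.

Lemma sphere_sphere_point r t : sphere (sphere_point r t : 'rV[R]_3).
Proof.
rewrite /sphere/= /dot !big_ord_recl big_ord0 /sphere_point /vec3 !mxE /=.
transitivity (sin r ^+ 2 * (cos t ^+ 2 + sin t ^+ 2) + cos r ^+ 2); first by ring.
by rewrite cos2Dsin2 mulr1 addrC cos2Dsin2.
Qed.

Lemma acos_le (u r : R) : -1 <= u <= 1 -> 0 <= r <= pi ->
  (acos u <= r) = (cos r <= u).
Proof.
move=> u1 rpi; have au : acos u \in `[0, pi] by rewrite in_itv/= acos_ge0// acos_lepi.
by rewrite -[in RHS](acosK u1) leNgt -ltr_cos// -leNgt.
Qed.

Lemma cos_le_cos (t th : R) : 0 <= th <= pi -> - pi < t <= pi ->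
  (cos th <= cos t) = (- th <= t <= th).
Proof.
move=> thpi /andP[t1 t2]; rewrite -ler_norml -(cos_norm t) leNgt ltr_cos//.
  by rewrite -leNgt.
by rewrite in_itv/= normr_ge0 ler_norml t2 ltW.
Qed.

(** The points of longitude [t] of the first circle that lie in the second disk
    are those with [|t| <= th], where [th] is the angle at the first center in
    the spherical triangle formed by the two centers and a vertex of the
    bigon. *)
Lemma bigon_side_lengthE x y : 0 <= x -> 0 <= y ->
  bigon_side_length (acot x) (acot y) phi =
  sin (acot x) * (2 * acot (cos (atan x) * ((y + x * cos phi) / sin phi))).
Proof.
move=> x0 y0; rewrite /bigon_side_length; congr (_ * _).
set Z := cos (atan x) * _; set th := acot Z.
pose Cx := cos (atan x); pose Cy := cos (atan y).
have Cx0 : 0 < Cx := cos_atan_gt0 x.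
have Cy0 : 0 < Cy := cos_atan_gt0 y.
have s0 := sin_phi_gt0 phi hphi.
have Z0 : 0 <= Z.
  rewrite mulr_ge0 ?(ltW Cx0)// divr_ge0 ?(ltW s0)// addr_ge0// mulr_ge0//.
  exact/ltW/cos_phi_gt0.
have th0 : 0 < th := acot_gt0 Z.
have th2 : th <= pi / 2.
  by rewrite /th /Defs.radius gerBl -(atan0 R) le_atan.
have pi0 := pi_gt0 R.
have Cx2 : Cx ^+ 2 * (1 + x ^+ 2) = 1 := cos_atan2 x.
have Cy2 : Cy ^+ 2 * (1 + y ^+ 2) = 1 := cos_atan2 y.
have CZ2 := cos_atan2 Z.
have sc2 := cos2Dsin2 phi.
set CZ := cos (atan Z) in CZ2.
have CZ0 : 0 < CZ := cos_atan_gt0 Z.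
(* the cosine of the distance between the centers *)
pose cd := x * y * Cx * Cy - Cx * Cy * cos phi.
have ZE : Z * sin phi = Cx * (y + x * cos phi).
  by rewrite /Z -/Cx; field; rewrite gt_eqF.
(* the sine rule in the triangle of the two centers and a vertex *)
have cdE : 1 - cd ^+ 2 = (Cy * sin phi / CZ) ^+ 2.
  have -> : (Cy * sin phi / CZ) ^+ 2 = (Cy * sin phi) ^+ 2 * (1 + Z ^+ 2).
    transitivity ((Cy * sin phi) ^+ 2 / CZ ^+ 2 * (CZ ^+ 2 * (1 + Z ^+ 2))).
      by rewrite CZ2; field; rewrite gt_eqF.
    by field; rewrite gt_eqF.
  apply/eqP; rewrite subr_eq eq_sym; apply/eqP.
  transitivity (Cy ^+ 2 * sin phi ^+ 2 + Cy ^+ 2 * (Z * sin phi) ^+ 2 + cd ^+ 2).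
    by ring.
  rewrite ZE; transitivity (Cy ^+ 2 *
      (Cx ^+ 2 * (1 + x ^+ 2) * (y ^+ 2 + cos phi ^+ 2) + sin phi ^+ 2)).
    by rewrite /cd; ring.
  by rewrite Cx2 mul1r -addrA sc2 addrC.
have cd1 : -1 <= cd <= 1.
  have : 0 <= 1 - cd ^+ 2 by rewrite cdE sqr_ge0.
  by move=> h; apply/andP; split; nra.
have sd : sin (acos cd) = Cy * sin phi / CZ.
  rewrite sin_acos// cdE sqrtr_sqr ger0_norm//.
  by rewrite divr_ge0// ?mulr_ge0// ltW.
set D2 := center_dist _ _ _.
have -> : D2 = acos cd.
  rewrite /D2 /center_dist !cos_acot !sin_acot !sin_atan -/Cx -/Cy; congr acos.
  by rewrite /cd; ring.
have ypi : 0 <= acot y <= pi.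
  rewrite ltW ?acot_gt0//=; apply: (@le_trans _ _ (pi / 2)); last by lra.
  by rewrite /Defs.radius gerBl -(atan0 R) le_atan.
have -> : [set t | - pi < t <= pi /\ round_disk (sphere_point (acos cd) 0)
    (acot y) (sphere_point (acot x) t)] = [set` `[- th, th]].
  have diskE t : - pi < t <= pi ->
      (sphere_dist (sphere_point (acos cd) 0) (sphere_point (acot x) t) <= acot y)
      = (- th <= t <= th).
    move=> tpi; rewrite -cos_le_cos//; last by apply/andP; split; lra.
    rewrite /sphere_dist acos_le//; last by apply: dot_le1; exact: sphere_sphere_point.
    rewrite dot_sphere_point sd acosK// !cos_acot !sin_acot !sin_atan.
    rewrite -/Cx -/Cy -/CZ.
    rewrite -[in RHS](@ler_pM2r _ (Cy * Cx * sin phi / CZ)); last first.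
      by rewrite divr_gt0// !mulr_gt0.
    rewrite -lerBlDr; congr (_ <= _); last by field; rewrite gt_eqF.
    transitivity (Cy * Cx * (Z * sin phi)); last by field; rewrite gt_eqF.
    rewrite ZE; transitivity (Cy * (y * (Cx ^+ 2 * (1 + x ^+ 2))
      - x ^+ 2 * y * Cx ^+ 2 + x * Cx ^+ 2 * cos phi)).
      by rewrite Cx2 /cd; ring.
    by ring.
  apply/seteqP; split => t /=; rewrite in_itv/=.
    by move=> [tpi [_]]; rewrite diskE.
  move=> tth; have tpi : - pi < t <= pi.
    by move/andP: tth => [t1 t2]; apply/andP; split; lra.
  by split=> //; split; [exact: sphere_sphere_point|rewrite diskE].
rewrite lebesgue_measure_itv/= lte_fin ifT; last by lra.
by rewrite -EFinB/=; ring.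
Qed.

End Length.

(** * Comparison and Perron's method for monotone systems *)

Section MonotoneSystem.
Context {R : realType} {I : finType}.
Variable T : (I -> R) -> I -> R.
Implicit Types (k : I -> R) (f g : I) (A : {set I}).

Hypothesis T_antitone : forall k k' f, (forall g, 0 <= k g <= k' g) ->
  k f = k' f -> T k' f <= T k f.

Section Comparison.
Hypothesis T_scale_lt : forall c k f, 1 < c -> (forall g, 0 <= k g) ->
  0 < k f -> T k f < T (fun g => c * k g) f.

(** Take [f] where the ratio [k / k'] is maximal and suppose that the maximum
    [c] exceeds 1.  Then [k <= c k'] with equality at [f], so that
    [T k f >= T (c k') f > T k' f]. *)
Lemma comparison_principle k k' :
  (forall f, 0 <= k f) -> (forall f, 0 <= k' f) ->
  (forall f, 0 < k f -> 0 < k' f) -> (forall f, 0 < k f -> T k f <= T k' f) ->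
  forall f, k f <= k' f.
Proof.
move=> k0 k'0 pos le_T f0; rewrite leNgt; apply/negP => lt0.
have kf0 : 0 < k f0 by apply: le_lt_trans lt0.
have [f kf fmax] :=
  @arg_maxP _ _ _ f0 (fun f => 0 < k f) (fun f => k f / k' f) kf0.
have k'f : 0 < k' f := pos _ kf.
pose c := k f / k' f.
have c1 : 1 < c.
  by apply: lt_le_trans (fmax f0 kf0); rewrite ltr_pdivlMr ?mul1r// pos.
have := T_scale_lt _ _ _ c1 k'0 k'f; rewrite ltNge => /negP; apply.
apply: le_trans (le_T f kf); apply: T_antitone => [g|]; last first.
  by rewrite /c divfK// gt_eqF.
rewrite k0/=; have [->|kg] := eqVneq (k g) 0.
  by rewrite mulr_ge0// ltW// (lt_trans _ c1).
have {}kg : 0 < k g by rewrite lt_neqAle eq_sym kg k0.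
by rewrite -ler_pdivrMr ?pos//; exact: fmax.
Qed.

End Comparison.

Section Perron.
Hypothesis T_continuous : forall k f,
  continuous (fun t => T [eta k with f |-> t] f).
Variables (A : {set I}) (L : I -> R).

Definition subsolution : set (I -> R) :=
  [set k | [/\ forall g, 0 <= k g, forall g, g \notin A -> k g = 0 &
               forall g, g \in A -> T k g <= L g]].

Hypothesis subsolution0 : subsolution (fun=> 0).

(** At [f], the larger of the two subsolutions agrees with the maximum, and
    passing to the maximum only raises the other values. *)
Lemma subsolution_max k k' : subsolution k -> subsolution k' ->
  subsolution (fun g => Num.max (k g) (k' g)).
Proof.
move=> [k0 kA kT] [k'0 k'A k'T]; split => [g|g gA|g gA].
- by rewrite le_max k0.
- by rewrite kA// k'A// maxxx.
- have [h|h] := leP (k g) (k' g).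
    apply: le_trans (k'T g gA); apply: T_antitone => [i|].
      by rewrite k'0/= le_max lexx orbT.
    by rewrite (max_idPr h).
  apply: le_trans (kT g gA); apply: T_antitone => [i|].
    by rewrite k0/= le_max lexx.
  by rewrite (max_idPl (ltW h)).
Qed.

(** The coordinatewise supremum [s] is a subsolution: if [T s f > L f], then
    [T s' f > L f] still holds when [s'] is obtained from [s] by lowering the
    value at [f] slightly, to that of a subsolution [k]; but [k <= s'] with
    equality at [f], so that [T s' f <= T k f <= L f].  It is a solution: if [T s f < L f], raising the value at [f] a little would give a
    subsolution that is larger than [s]. *)
Lemma perron_solution B :
  (forall k f, subsolution k -> k f <= B) ->
  exists2 k, subsolution k & forall f, f \in A -> T k f = L f.
Proof.
move=> kB; pose U f : set R := [set k f | k in subsolution].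
have Usup f : has_sup (U f).
  split; first by exists 0, (fun=> 0).
  by exists B => _ [k kU <-]; exact: kB.
pose s f : R := sup (U f).
have les k f : subsolution k -> k f <= s f.
  by move=> kU; apply: (sup_upper_bound (Usup f)); exists k.
have s0 f : 0 <= s f by exact: (les (fun=> 0)).
have upd_s f : ([eta s with f |-> s f] : I -> R) = s.
  by apply/funext => g /=; case: eqP => [->|].
have sT g : g \in A -> T s g <= L g.
  move=> gA; rewrite leNgt; apply/negP => LT.
  have /nbhs_ballP[e /= e0 eL] :
      \forall t \near s g, L g < T [eta s with g |-> t] g.
    by apply: (cvgr_gt _ (T_continuous s g (s g))); rewrite upd_s.
  have [_ [k kU <-] kg] := sup_adherent e0 (Usup g).
  have /eL/= : ball (s g) e (k g).
    rewrite /ball/= ger0_norm ?subr_ge0 ?les//; move: kg; rewrite -/(s g); lra.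
  apply/negP; rewrite -leNgt; have [k0 _ kT] := kU.
  apply: le_trans (kT g gA); apply: T_antitone => [i /=|]; last by rewrite /= eqxx.
  by rewrite k0/=; case: eqP => [->|_]; rewrite ?lexx ?les.
have sU : subsolution s.
  split=> // g gA; apply/eqP; rewrite eq_le s0 andbT.
  apply: ge_sup; first by case: (Usup g).
  by move=> _ [k [_ kA _] <-]; rewrite kA.
exists s => // f fA; apply/eqP; rewrite eq_le sT//= leNgt; apply/negP => TL.
have /nbhs_ballP[e /= e0 eL] :
    \forall t \near s f, T [eta s with f |-> t] f < L f.
  by apply: (cvgr_lt _ (T_continuous s f (s f))); rewrite upd_s.
have /eL/= TL' : ball (s f) e (s f + e / 2).
  by rewrite /ball/= opprD addNKr normrN ger0_norm; lra.
suff /(les _ f) : subsolution [eta s with f |-> s f + e / 2].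
  by rewrite /= eqxx; lra.
split=> [g|g gA|g gA] /=.
- by case: eqP => // _; rewrite addr_ge0// ltW// divr_gt0.
- by rewrite ifN; [case: sU => _ + _; exact|apply: contraNneq gA => ->].
- have [->|gf] := eqVneq g f; first exact: ltW.
  apply: le_trans (sT g gA); apply: T_antitone => [i /=|]; last first.
    by rewrite /= (negPf gf).
  rewrite s0/=; case: eqP => [->|//]; lra.
Qed.

(** Since subsolutions are stable under maxima, the coordinates that are
    unbounded on them can be made large simultaneously. *)
Lemma subsolution_blowup :
  (exists B, forall k f, subsolution k -> k f <= B) \/
  exists (F' : {set I}) B, [/\ F' != finset.set0, F' \subset A, 0 <= B &
    forall M, exists2 k, subsolution k &
      (forall f, f \in F' -> M <= k f) /\ (forall f, f \notin F' -> k f <= B)].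
Proof.
pose bnd f (b : R) := forall k, subsolution k -> k f <= b.
pose F' : {set I} := finset (fun f => `[< ~ exists b, bnd f b >]).
have bF' f : exists b, f \notin F' -> bnd f b.
  have [[b fb]|nb] := pselect (exists b, bnd f b); first by exists b.
  by exists 0; rewrite inE => /asboolPn.
have [b {}bF'] := choice bF'.
pose B : R := \sum_f `|b f|.
have B0 : 0 <= B by apply: sumr_ge0.
have bB k f : subsolution k -> f \notin F' -> k f <= B.
  move=> kU fF'; apply: le_trans (bF' f fF' k kU) _.
  rewrite (le_trans (ler_norm _))// /B (bigD1 f)//= lerDl.
  exact: sumr_ge0.
have [F'0|F'0] := eqVneq F' finset.set0.
  by left; exists B => k f kU; apply: bB; rewrite ?F'0 ?inE.
right; exists F', B; split=> // [|M].
  apply/fintype.subsetP => f; rewrite inE => /asboolP nb.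
  apply: contrapT => /negP fA; apply: nb; exists 0 => k [_ kA _].
  by rewrite kA.
suff [k kU kM] :
    exists2 k, subsolution k & forall f, f \in enum F' -> M <= k f.
  exists k => //; split=> f fF'; last exact: bB.
  by apply: kM; rewrite mem_enum.
have : {subset enum F' <= F'} by move=> f; rewrite mem_enum.
elim: (enum F') => [|f l IH] lF'; first by exists (fun=> 0).
have [|k kU kM] := IH; first by move=> g gl; apply: lF'; rewrite inE gl orbT.
have [k' k'U k'M] : exists2 k', subsolution k' & M <= k' f.
  have := lF' f (mem_head _ _); rewrite inE => /asboolP nb.
  apply: contrapT => h; apply: nb; exists M => k' k'U.
  by rewrite leNgt; apply/negP => /ltW k'M; apply: h; exists k'.
exists (fun g => Num.max (k g) (k' g)); first exact: subsolution_max.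
move=> g; rewrite inE => /predU1P[->|gl]; rewrite le_max ?k'M ?orbT//.
by rewrite kM.
Qed.

End Perron.
End MonotoneSystem.

(** * Total curvatures on a graph *)

Section EdgeBounds.
Context {R : realType}.
Variable phi : R.
Hypothesis hphi : 0 < phi < pi / 2.
Implicit Types (x y B M : R) (b : bool).

(** The booleans tell which sides of the edge lie in the set of faces over which
    one sums. *)
Lemma edge_curvature_lt b1 b2 x y : b1 || b2 -> 0 <= x -> 0 <= y ->
  (b1 -> 0 < x) -> (b2 -> 0 < y) ->
  (if b1 then bigon_curvature phi x y else 0) +
  (if b2 then bigon_curvature phi y x else 0) < 2 * phi.
Proof.
have one u v : 0 < u -> 0 <= v -> bigon_curvature phi u v < 2 * phi.
  move=> u0 v0; apply: lt_le_trans (bigon_curvature_lt_flat _ hphi _ _ u0 v0) _.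
  by rewrite ler_pM2l// flat_angle_le.
case: b1; case: b2 => //= _ x0 y0 hx hy; rewrite ?addr0 ?add0r ?one ?hx ?hy//.
rewrite -[X in 2 * X](flat_angle_sum _ hphi x y) ?hx ?hy// mulrDr.
by rewrite ltrD// bigon_curvature_lt_flat ?hx ?hy.
Qed.

(** Large curvature on the sides that count and bounded curvature on the others
    make the contribution almost [2 * phi] (see [flat_bound_cvg]).  When both
    sides count this bound does not depend on their ratio, since the two flat
    angles add up to [phi] whatever it is. *)
Lemma edge_curvature_ge b1 b2 x y B M : 0 < M -> 0 <= B -> b1 || b2 ->
  0 <= x -> 0 <= y -> (b1 -> M <= x) -> (b2 -> M <= y) ->
  (~~ b1 -> x <= B) -> (~~ b2 -> y <= B) ->
  2 * (sin (atan M) * flat_angle phi M B) <=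
  (if b1 then bigon_curvature phi x y else 0) +
  (if b2 then bigon_curvature phi y x else 0).
Proof.
move=> M0 B0.
have sM0 : 0 < sin (atan M) by exact: sin_atan_gt0.
have sM u : M <= u -> sin (atan M) <= sin (atan u).
  by rewrite le_eqVlt => /predU1P[->//|/sin_atan_lt/ltW].
have ge_flat u v : M <= u -> 0 <= v ->
    2 * (sin (atan M) * flat_angle phi u v) <= bigon_curvature phi u v.
  move=> Mu v0; have u0 : 0 < u := lt_le_trans M0 Mu.
  apply: le_trans (bigon_curvature_ge_flat _ hphi _ _ u0 v0).
  by rewrite ler_pM2l// ler_pM2r ?acot_gt0// sM.
have one u v : M <= u -> 0 <= v -> v <= B ->
    2 * (sin (atan M) * flat_angle phi M B) <= bigon_curvature phi u v.
  move=> Mu v0 vB; apply: le_trans (ge_flat _ _ Mu v0).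
  have u0 : 0 < u := lt_le_trans M0 Mu.
  rewrite ler_pM2l// ler_pM2l// acot_le// ler_pM2r ?invr_gt0 ?sin_phi_gt0//.
  by rewrite lerD2r ler_pM ?invr_ge0 ?(ltW u0)// lef_pV2.
case: b1; case: b2 => //= _ x0 y0 hx hy nx ny; rewrite ?addr0 ?add0r.
- have Mx := hx isT; have My := hy isT.
  apply: le_trans (lerD (ge_flat _ _ Mx y0) (ge_flat _ _ My x0)).
  rewrite -mulrDr -mulrDr (flat_angle_sum _ hphi) ?(lt_le_trans M0)//.
  by rewrite ler_pM2l// ler_pM2l// flat_angle_le.
- by rewrite one ?hx ?ny.
- by rewrite one ?hy ?nx.
Qed.

Lemma flat_bound_cvg B :
  2 * (sin (atan M) * flat_angle phi M B) @[M --> +oo] --> 2 * phi.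
Proof.
apply: cvgMl_tmp; rewrite -[phi in _ --> phi]mul1r -(sin_pihalf R); apply: cvgM.
  by apply: continuous_cvg; [exact: continuous_sin|exact: cvgy_atan].
rewrite -[phi in _ --> phi](acot_cot_phi _ hphi).
rewrite /flat_angle; apply: (@continuous_cvg _ _ _ _ _
  (fun M => (B / M + cos phi) / sin phi) acot); first exact: continuous_acot.
suff : (B / M + cos phi) / sin phi @[M --> +oo] --> (B * 0 + cos phi) / sin phi.
  by rewrite mulr0 add0r.
apply: cvgMr_tmp; apply: cvgD; last exact: cvg_cst.
by apply: cvgMl_tmp; apply/gtr0_cvgV0; [exact: nbhs_pinfty_gt|exact: cvg_id].
Qed.

End EdgeBounds.

Section Graph.
Context {R : realType} {I E : finType}.
Variables (s1 s2 : E -> I) (Phi : E -> R).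
Hypothesis hPhi : forall e, 0 < Phi e < pi / 2.
Hypothesis has_edge : forall f, exists e, (s1 e == f) || (s2 e == f).
Implicit Types (k L : I -> R) (f g : I) (J A : {set I}).

(** A loop at [f] contributes both its sides. *)
Definition vertex_curvature k f : R :=
  \sum_e ((if s1 e == f then bigon_curvature (Phi e) (k f) (k (s2 e)) else 0) +
          (if s2 e == f then bigon_curvature (Phi e) (k f) (k (s1 e)) else 0)).

Definition incident J e := (s1 e \in J) || (s2 e \in J).

Lemma sum_vertex_curvature k J :
  \sum_(f in J) vertex_curvature k f =
  \sum_(e | incident J e)
    ((if s1 e \in J then bigon_curvature (Phi e) (k (s1 e)) (k (s2 e)) else 0) +
     (if s2 e \in J then bigon_curvature (Phi e) (k (s2 e)) (k (s1 e)) else 0)).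
Proof.
have pick (G : I -> R) i :
    \sum_(f in J) (if i == f then G f else 0) = if i \in J then G i else 0.
  rewrite -big_mkcondr; case: ifP => iJ.
    by rewrite (big_pred1 i)// => j /=; rewrite eq_sym andb_idl// => /eqP->.
  by rewrite big_pred0// => j; apply: contraFF iJ => /andP[jJ /eqP->].
rewrite exchange_big /= [RHS]big_mkcond; apply: eq_bigr => e _.
rewrite big_split /= !pick /incident.
by case: ifP => _ //; case: ifP => _ //; rewrite addr0.
Qed.

Lemma vertex_curvature0 k f : k f = 0 -> vertex_curvature k f = 0.
Proof.
by move=> kf; apply: big1 => e _; rewrite kf !bigon_curvature0 !if_same addr0.
Qed.

(** Strictness requires an edge at [f]. *)
Lemma vertex_curvature_lt k k' f :
  (forall e, s1 e = f -> bigon_curvature (Phi e) (k f) (k (s2 e)) <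
                         bigon_curvature (Phi e) (k' f) (k' (s2 e))) ->
  (forall e, s2 e = f -> bigon_curvature (Phi e) (k f) (k (s1 e)) <
                         bigon_curvature (Phi e) (k' f) (k' (s1 e))) ->
  vertex_curvature k f < vertex_curvature k' f.
Proof.
move=> h1 h2; have [e0 e0f] := has_edge f.
have le e : (if s1 e == f then bigon_curvature (Phi e) (k f) (k (s2 e)) else 0) +
            (if s2 e == f then bigon_curvature (Phi e) (k f) (k (s1 e)) else 0)
          <= (if s1 e == f then bigon_curvature (Phi e) (k' f) (k' (s2 e)) else 0) +
            (if s2 e == f then bigon_curvature (Phi e) (k' f) (k' (s1 e)) else 0)
            ?= iff ~~ ((s1 e == f) || (s2 e == f)).
  apply/leifP; case: eqP => [/h1 ?|_]; case: eqP => [/h2 ?|_] //=.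
  - by rewrite ltrD.
  - by rewrite !addr0.
  - by rewrite !add0r.
rewrite /vertex_curvature (bigD1 e0)//= [ltRHS](bigD1 e0)//=.
rewrite ltr_leD//; last by apply: ler_sum => e _; exact: le.
by rewrite (lt_leif (le e0)) e0f.
Qed.

Lemma vertex_curvature_gt0 k f : 0 < k f -> 0 < vertex_curvature k f.
Proof.
move=> kf; rewrite -(vertex_curvature0 (fun=> 0) f erefl).
by apply: vertex_curvature_lt => e _; rewrite bigon_curvature0 bigon_curvature_gt0.
Qed.

Lemma vertex_curvature_scale_lt c k f : 1 < c -> (forall g, 0 <= k g) ->
  0 < k f -> vertex_curvature k f < vertex_curvature (fun g => c * k g) f.
Proof.
move=> c1 k0 kf.
by apply: vertex_curvature_lt => e _; exact: bigon_curvature_scale_lt.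
Qed.

Lemma vertex_curvature_antitone k k' f : (forall g, 0 <= k g <= k' g) ->
  k f = k' f -> vertex_curvature k' f <= vertex_curvature k f.
Proof.
move=> kk' kf; apply: ler_sum => e _; rewrite -kf.
have k0 : 0 <= k f by case/andP: (kk' f).
by apply: lerD; case: ifP => // _; apply: bigon_curvature_antitone => //;
  rewrite (andP (kk' _)).2.
Qed.

Lemma vertex_curvature_continuous k f :
  continuous (fun t => vertex_curvature [eta k with f |-> t] f).
Proof.
move=> t; rewrite /vertex_curvature.
have cont (e : E) g (b : bool) :
  (if b then bigon_curvature (Phi e) u ([eta k with f |-> u] g) else 0)
    @[u --> t] -->
  (if b then bigon_curvature (Phi e) t ([eta k with f |-> t] g) else 0).
  case: b; last exact: cvg_cst.
  apply: (continuous_bigon_curvature (Phi e) (fun u => [eta k with f |-> u] g)) => u /=.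
  (* [g = f] occurs at loops *)
  by case: (g == f); [exact: cvg_id|exact: cvg_cst].
apply: cvg_big => [|e _].
  exact: add_continuous.
by rewrite /= eqxx; apply: cvgD; exact: cont.
Qed.

Lemma vertex_curvature_sum_lt k J : (forall g, 0 <= k g) ->
  (forall f, f \in J -> 0 < k f) -> J != finset.set0 ->
  \sum_(f in J) vertex_curvature k f < 2 * \sum_(e | incident J e) Phi e.
Proof.
move=> k0 kJ /set0Pn[f fJ]; have [e ef] := has_edge f.
rewrite sum_vertex_curvature mulr_sumr; apply: ltr_sum => [|e' e'J].
  apply/hasP; exists e; first exact: mem_index_enum.
  by case/orP: ef => /eqP ef; rewrite /incident ef fJ ?orbT.
by apply: edge_curvature_lt => //; exact: kJ.
Qed.

Lemma vertex_curvature_inj k k' :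
  (forall f, 0 <= k f) -> (forall f, 0 <= k' f) ->
  vertex_curvature k =1 vertex_curvature k' -> k =1 k'.
Proof.
have half k1 k2 : (forall f, 0 <= k1 f) -> (forall f, 0 <= k2 f) ->
    vertex_curvature k1 =1 vertex_curvature k2 -> forall f, k1 f <= k2 f.
  move=> k10 k20 eqk; apply: (comparison_principle vertex_curvature).
  - exact: vertex_curvature_antitone.
  - exact: vertex_curvature_scale_lt.
  - exact: k10.
  - exact: k20.
  - move=> f k1f; rewrite lt_neqAle k20 andbT eq_sym; apply/eqP => k2f.
    by have := vertex_curvature_gt0 _ _ k1f; rewrite eqk vertex_curvature0// ltxx.
  - by move=> f _; rewrite eqk.
by move=> k0 k'0 eqk f; apply/eqP; rewrite eq_le !half.
Qed.

Lemma vertex_curvature_surj A L : (forall f, f \in A -> 0 < L f) ->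
  (forall J, J != finset.set0 -> J \subset A ->
    \sum_(f in J) L f < 2 * \sum_(e | incident J e) Phi e) ->
  exists k, [/\ forall f, 0 <= k f, forall f, f \notin A -> k f = 0 &
    forall f, f \in A -> vertex_curvature k f = L f].
Proof.
move=> L0 LPhi.
have sub0 : subsolution vertex_curvature A L (fun=> 0).
  by split=> // g gA; rewrite vertex_curvature0// ltW// L0.
suff [B kB] :
    exists B, forall k f, subsolution vertex_curvature A L k -> k f <= B.
  have [k [k0 kA kT] kL] := perron_solution _ vertex_curvature_antitone
    vertex_curvature_continuous A L sub0 B kB.
  by exists k.
have [//|[J [B [J0 JA B0 blowup]]]] :=
  subsolution_blowup _ vertex_curvature_antitone A L sub0.
have lim : \sum_(e | incident J e)
    2 * (sin (atan M) * flat_angle (Phi e) M B) @[M --> +oo] -->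
    \sum_(e | incident J e) 2 * Phi e.
  apply: cvg_big => [|e _]; first exact: add_continuous.
  exact: flat_bound_cvg.
have /(cvgr_gt _ lim) near_lim :
    \sum_(f in J) L f < \sum_(e | incident J e) 2 * Phi e.
  by rewrite -mulr_sumr LPhi.
have [M [ML M0]] := filter_ex (filterI near_lim (nbhs_pinfty_gt (num_real 0))).
have [k [k0 kA kT] [kM kB]] := blowup M.
suff : \sum_(f in J) L f < \sum_(f in J) L f by rewrite ltxx.
apply: lt_le_trans ML _.
apply: le_trans (_ : \sum_(f in J) vertex_curvature k f <= _); last first.
  by apply: ler_sum => f fJ; rewrite kT// (fintype.subsetP JA).
rewrite sum_vertex_curvature; apply: ler_sum => e eJ.
by apply: edge_curvature_ge => //; [exact: kM|exact: kM|exact: kB|exact: kB].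
Qed.

End Graph.

(** * The dual graph of a cellular decomposition *)

Section Cells.
Context {R : realType} {S : topologicalType}.
Variable D : cellular_decomposition R S.
Implicit Types (e : E D) (f : 'I_(nF D)).

Lemma cell1_cell2 e f x : cell1 e x -> cell2 f x -> False.
Proof.
move=> ex fx.
by have := @cells_disjoint _ _ D (inl (inr e)) (inr f) I I
  (ex_intro _ x (conj ex fx)).
Qed.

Lemma cell1_nonempty e : exists x, cell1 e x.
Proof.
by exists (Defs.arc e 0), 0 => //=; rewrite in_itv/= ltrN10 ltr01.
Qed.

(** A chart around a point of [e] meets only [e] and the 2-cells on its two
    sides, so no other 2-cell has [e] in its closure; and both of these 2-cells
    accumulate at every point of [e]. *)
Lemma edges_of_faceE e f :
  (e \in edges_of_face f) = (side1 e == f) || (side2 e == f).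
Proof.
have limit (h : R * R -> S) (s : R) (A : set S) : open_embedding h ->
    `|s| = 1 -> (forall t, 0 < t -> A (h (0, s * t))) -> closure A (h (0, 0)).
  move=> [hc _ _] s1 hA B /hc/nbhs_ballP[r /= r0 rB].
  exists (h (0, s * (r / 2))); split; first by apply: hA; rewrite divr_gt0.
  apply: rB; split => /=; first exact: ballxx.
  rewrite /ball/= sub0r normrN normrM s1 mul1r gtr0_norm ?divr_gt0//; lra.
rewrite /edges_of_face inE; apply/asboolP/idP => [ef|].
  have [x ex] := cell1_nonempty e.
  have [h [[hc hi ho] hx hs]] := sides ex.
  have [fx _] := ef x ex.
  have /fx[y [fy [[s t] _ hy]]] : nbhs x (h @` setT).
    by apply: open_nbhs_nbhs; split; [apply: ho; exact: openT|exists (0, 0)].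
  have [h0 h1 h2] := hs s t; rewrite hy in h0 h1 h2.
  have same g : cell2 g y -> g = f.
    move=> gy.
    by have [] := @cells_disjoint _ _ D (inr g) (inr f) I I
      (ex_intro _ y (conj gy fy)).
  case: (ltgtP t 0) => [/h2/same->|/h1/same->|/h0 ey]; rewrite ?eqxx ?orbT//.
  by case: (cell1_cell2 _ _ _ ey fy).
move=> ef x ex; split; last by move=> /(cell1_cell2 _ _ _ ex).
have [h [he <- hs]] := sides ex.
case/orP: ef => /eqP <-.
  apply: (limit h 1) => //; first exact: normr1.
  move=> t t0; by have [_ + _] := hs 0 (1 * t); apply; rewrite mul1r.
apply: (limit h (-1)) => //; first by rewrite normrN1.
move=> t t0; have [_ _] := hs 0 (-1 * t); apply.
by rewrite mulN1r oppr_lt0.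
Qed.

(** Without 2-cells there would be no 1-cells either, because a 1-cell has
    2-cells on its sides; the surface would then consist of finitely many
    vertices, whereas a chart contains infinitely many points. *)
Lemma has_face : closed_surface R S -> (0 < nF D)%N.
Proof.
move=> [[x0 _] _ _ charts]; rewrite lt0n; apply/negP => /eqP n0.
have nof (f : 'I_(nF D)) : False by case: f => i; rewrite n0.
have vtx_surj x : exists v : V D, vtx v = x.
  have : [set: S] x by [].
  rewrite -(cells_cover D) => -[[[v _ <-]|[e _ _]]|[f _ _]].
  - by exists v.
  - by case: (nof (side1 e)).
  - by case: (nof f).
have [h [_ hinj _] _] := charts x0.
have [v vP] := choice (fun n : nat => vtx_surj (h (n%:R, 0))).
have : injective (fun i : 'I_#|V D|.+1 => v i).
  move=> i j vij; have := vP i; rewrite vij vP => /hinj[/eqP].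
  by rewrite eqr_nat eq_sym => /eqP ij; exact: val_inj.
by move=> /leq_card; rewrite card_ord ltnn.
Qed.

End Cells.

Section Reduction.
Context {R : realType} {S : topologicalType}.
Variables (D : cellular_decomposition R S) (Phi : E D -> R).
Hypothesis hPhi : forall e, 0 < Phi e < pi / 2.
Implicit Types (k : 'cV[R]_(nF D)) (f g : 'I_(nF D)).

Lemma side_curvatureE k f g phi : 0 < phi < pi / 2 ->
  spherical_conical_metric k ->
  side_curvature k f g phi = bigon_curvature phi (k f 0) (k g 0).
Proof.
move=> hphi k0; rewrite /side_curvature bigon_side_lengthE ?k0//.
by rewrite /bigon_curvature sin_acot sin_atan; ring.
Qed.

Lemma total_curvatureE k f : spherical_conical_metric k ->
  total_curvature Phi k f =
  vertex_curvature (@side1 _ _ D) (@side2 _ _ D) Phi (fun g => k g 0) f.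
Proof.
move=> k0; rewrite /total_curvature big_mkcond; apply: eq_bigr => e _.
rewrite edges_of_faceE /edge_curvature !side_curvatureE//.
by case: ifP => // /norP[/negPf-> /negPf->]; rewrite addr0.
Qed.

Lemma edges_of_facesE (J : {set 'I_(nF D)}) e :
  (e \in edges_of_faces J) = incident (@side1 _ _ D) (@side2 _ _ D) J e.
Proof.
rewrite /edges_of_faces inE; apply/existsP/orP => [[f /andP[fJ]]|].
  by rewrite edges_of_faceE => /orP[] /eqP ->; [left|right].
case=> eJ; [exists (side1 e)|exists (side2 e)];
  by rewrite eJ edges_of_faceE eqxx ?orbT.
Qed.

Lemma face_is_side f : exists e, (side1 e == f) || (side2 e == f).
Proof.
have [e ef] := face_has_edge f; exists e; rewrite -edges_of_faceE inE.
exact/asboolP.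
Qed.

End Reduction.

(** * Degenerated circle pattern metrics *)

Theorem theorem1p7 (R : realType) (S : topologicalType)
    (hS : closed_surface R S) (D : cellular_decomposition R S)
    (Phi : E D -> R) (hPhi : forall e, 0 < Phi e < pi / 2)
    (L : 'cV[R]_(nF D)) :
  ((exists k : 'cV[R]_(nF D),
      degenerated_metric k /\ has_total_curvature Phi k L)
     <-> degenerated_curvatures Phi L) /\
  (forall k k' : 'cV[R]_(nF D),
     degenerated_metric k -> has_total_curvature Phi k L ->
     degenerated_metric k' -> has_total_curvature Phi k' L ->
     k = k').
Proof.
have hE := @face_is_side R S D.
have sumE (J : {set 'I_(nF D)}) : \sum_(e in edges_of_faces J) Phi e =
    \sum_(e | incident (@side1 _ _ D) (@side2 _ _ D) J e) Phi e.
  by apply: eq_bigl => e; rewrite edges_of_facesE.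
split; last first.
  move=> k k' [k0 _] kL [k'0 _] k'L.
  have eqk := vertex_curvature_inj _ _ Phi hPhi hE
    (fun g => k g 0) (fun g => k' g 0) k0 k'0.
  apply/matrixP => f j; rewrite ord1; apply: eqk => {}f.
  by rewrite -!total_curvatureE// kL k'L.
split=> [[k [[k0 [f0 kf0]] kL]]|].
  pose A : {set 'I_(nF D)} := finset (fun f => 0 < k f 0).
  have LE f : L f 0 =
      vertex_curvature (@side1 _ _ D) (@side2 _ _ D) Phi (fun g => k g 0) f.
    by rewrite -total_curvatureE// kL.
  have LA f : f \notin A -> L f 0 = 0.
    rewrite inE -leNgt => kf; rewrite LE vertex_curvature0//.
    by apply/eqP; rewrite eq_le kf k0.
  have [A0|A0] := eqVneq A finset.set0.
    by right; apply/matrixP => f j; rewrite ord1 mxE LA// A0 inE.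
  left; exists A => /=.
    rewrite card_gt0 A0/= leq_subRL; last first.
      exact: leq_ltn_trans (ltn_ord f0).
    rewrite add1n -[X in (_ < X)%N]card_ord -cardsT proper_card//.
    rewrite properE finset.subsetT/=; apply/subsetPn; exists f0; rewrite ?inE//.
    by rewrite kf0 ltxx.
  split=> // [f|J J0 JA].
    by rewrite inE LE; exact: (vertex_curvature_gt0 _ _ Phi hE (fun g => k g 0)).
  rewrite sumE (eq_bigr _ (fun f _ => LE f)).
  apply: vertex_curvature_sum_lt => // f /(fintype.subsetP JA).
  by rewrite inE.
case=> [[A /= /andP[A1 An] [LA nLA LPhi]]|->].
  have LPhi' J : J != finset.set0 -> J \subset A -> \sum_(f in J) L f 0 <
      2 * \sum_(e | incident (@side1 _ _ D) (@side2 _ _ D) J e) Phi e.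
    by move=> J0 JA; rewrite -sumE LPhi.
  have [k [k0 nkA kL]] := vertex_curvature_surj _ _ Phi hPhi A
    (fun f => L f 0) LA LPhi'.
  have kE : (fun f => (\col_f k f) f 0) = k by apply/funext => f; rewrite mxE.
  have k'0 : spherical_conical_metric (\col_f k f) by move=> f; rewrite mxE.
  exists (\col_f k f); split; [split=> //|].
    have [f fA] : exists f, f \notin A.
      apply/existsP; rewrite -negb_forall; apply/negP => /forallP fA.
      have AE : A = [set: 'I_(nF D)]%SET by apply/setP => f; rewrite fA inE.
      move: A1 An; rewrite AE cardsT card_ord subn1 => n0.
      by rewrite leqNgt ltn_predL n0.
    by exists f; rewrite mxE nkA.
  move=> f; rewrite total_curvatureE// kE; have [fA|fA] := boolP (f \in A).
    exact: kL.
  by rewrite nLA// vertex_curvature0// nkA.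
have k0 : spherical_conical_metric (0 : 'cV[R]_(nF D)) by move=> g; rewrite mxE.
exists 0; split.
  by split=> //; exists (Ordinal (has_face D hS)); rewrite mxE.
by move=> g; rewrite total_curvatureE// vertex_curvature0 mxE.
Qed.
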